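(* Let $p$ be an odd prime, $\Bbbk$ a field of characteristic $p$, $G=\langle\sigma\rangle$ a cyclic group of order $p$, $V=V_3$ and $1\le n\le p$. Then $K_n=\ker(\Delta^n)\subseteq\Bbbk[V]$ is a free module over $A=\Bbbk[a_1,a_2,a_3]$, (freely) generated by $$S_n=\{M_0,M_1,\ldots,M_{n-1},\ \Delta^{p-n}(P_0),\Delta^{p-n}(P_1),\ldots,\Delta^{p-n}(P_{n-1})\}.$$
   Context: $V_3$ is the indecomposable $\Bbbk G$-module of dimension $3$; $\Bbbk[V]=S(V^* )=\Bbbk[x_1,x_2,x_3]$ with $\sigma$ acting by algebra automorphisms, $\sigma x_1=x_1+x_2$, $\sigma x_2=x_2+x_3$, $\sigma x_3=x_3$. $\Delta=\sigma-1$ acting on $\Bbbk[V]$. $A$ is the subalgebra of $\Bbbk[V]^G$ generated by the invariants $a_1=x_3$, $a_2=x_2^2-2x_1x_3-x_2x_3$, $a_3=\prod_{i=0}^{p-1}\sigma^i(x_1)$. For $0\le i\le n-1$: $M_i=x_1^{i/2}$ if $i$ is even and $M_i=x_1^{(i-1)/2}x_2$ if $i$ is odd; $P_0=x_1^{p-1}x_2$, $P_i=\Delta(x_1^{p-i/2})$ if $i>0$ is even, and $P_i=x_1^{p-(i+1)/2}$ if $i$ is odd. *)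

(* Defs.v *)
From mathcomp Require Import all_boot all_order all_algebra.
From mathcomp Require Import mpoly ring.
Set Implicit Arguments.
Unset Strict Implicit.
Unset Printing Implicit Defensive.
Import GRing.Theory.
Local Open Scope ring_scope.

Inductive subalg_gen (k : comNzRingType) (B : comAlgType k) (S : B -> Prop)
  : B -> Prop :=
| SubalgGen  f   of S f : subalg_gen S f
| SubalgOne             : subalg_gen S 1
| SubalgAdd  f g of subalg_gen S f & subalg_gen S g : subalg_gen S (f + g)
| SubalgMul  f g of subalg_gen S f & subalg_gen S g : subalg_gen S (f * g)
| SubalgScal c f of subalg_gen S f : subalg_gen S (c *: f).

Definition submodule_over (B : comNzRingType) (A K : B -> Prop) : Prop :=
  [/\ K 0,
      forall f g, K f -> K g -> K (f + g)
    & forall a f, A a -> K f -> K (a * f)].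

(* The basis is a family, so its members are in particular pairwise distinct. *)
Record free_module_on (B : comNzRingType) (A K : B -> Prop)
    (I : finType) (b : I -> B) : Prop := FreeModuleOn {
  free_submodule : submodule_over A K;
  free_mem   : forall i, K (b i);
  free_span  : forall f, K f ->
    exists2 c : I -> B, (forall i, A (c i)) & f = \sum_i c i * b i;
  free_indep : forall c : I -> B, (forall i, A (c i)) ->
    \sum_i c i * b i = 0 -> forall i, c i = 0
}.

Section V3.
Variable k : fieldType.

Definition x1 : {mpoly k[3]} := 'X_(@Ordinal 3 0 isT).
Definition x2 : {mpoly k[3]} := 'X_(@Ordinal 3 1 isT).
Definition x3 : {mpoly k[3]} := 'X_(@Ordinal 3 2 isT).

(* On the linear forms (the dual of V_3) sigma is a single unipotent Jordan
   block of size 3; in odd characteristic p it has order p (see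
   sigma_iter_char and sigma_neq_id), so its iterates are the action of a
   cyclic group of order p generated by sigma. *)
Definition sigma (f : {mpoly k[3]}) : {mpoly k[3]} :=
  f \mPo [tuple x1 + x2; x2 + x3; x3].

Definition Delta (f : {mpoly k[3]}) : {mpoly k[3]} := sigma f - f.

Definition a1 : {mpoly k[3]} := x3.
Definition a2 : {mpoly k[3]} := x2 ^+ 2 - 2%:R * x1 * x3 - x2 * x3.
Definition a3 (p : nat) : {mpoly k[3]} := \prod_(i < p) iter i sigma x1.

Definition subalgA (p : nat) : {mpoly k[3]} -> Prop :=
  subalg_gen (fun f => [\/ f = a1, f = a2 | f = a3 p]).

Definition kerDelta (n : nat) (f : {mpoly k[3]}) : Prop := iter n Delta f = 0.

(* The divisions by 2 below are exact. *)
Definition Mpol (i : nat) : {mpoly k[3]} :=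
  if odd i then x1 ^+ ((i - 1) %/ 2) * x2 else x1 ^+ (i %/ 2).

Definition Ppol (p i : nat) : {mpoly k[3]} :=
  if i == 0%N then x1 ^+ (p - 1) * x2
  else if odd i then x1 ^+ (p - (i + 1) %/ 2)
  else Delta (x1 ^+ (p - i %/ 2)).

Definition basisS (p n : nat) (i : 'I_n + 'I_n) : {mpoly k[3]} :=
  match i with
  | inl j => Mpol j
  | inr j => iter (p - n) Delta (Ppol p j)
  end.

Lemma sigmaX1 : sigma x1 = x1 + x2. Proof. exact: comp_mpolyXU. Qed.
Lemma sigmaX2 : sigma x2 = x2 + x3. Proof. exact: comp_mpolyXU. Qed.
Lemma sigmaX3 : sigma x3 = x3. Proof. exact: comp_mpolyXU. Qed.

Lemma sigma_iter_char (p : nat) (f : {mpoly k[3]}) :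
  odd p -> p \in [pchar k] -> iter p sigma f = f.
Proof.
move=> p_odd pcharp.
have sD g h : sigma (g + h) = sigma g + sigma h by apply: raddfD.
have sMn g m : sigma (g *+ m) = sigma g *+ m by apply: raddfMn.
have hX m : [/\ iter m sigma x1 = x1 + x2 *+ m + x3 *+ 'C(m, 2),
  iter m sigma x2 = x2 + x3 *+ m & iter m sigma x3 = x3].
  elim: m => [|m [h1 h2 h3]] /=; first by rewrite !mulr0n !addr0.
  rewrite h1 h2 h3 !sD !sMn sigmaX1 sigmaX2 sigmaX3; split=> //.
    rewrite binS bin1 mulrS mulrnDl mulrnDr.
    by rewrite -!addrA; congr (_ + (_ + (_ + _))); rewrite addrC.
  by rewrite mulrS addrA.
have pr := pcharf_prime pcharp.
have p0 (g : {mpoly k[3]}) m : (p %| m)%N -> g *+ m = 0.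
  by move=> dvd; rewrite -scaler_nat (eqP (_ : m%:R == 0 :> k)) ?scale0r //
    -(dvdn_pcharf pcharp).
have p_gt2 : (2 < p)%N by case: (p) p_odd pr => [|[|[|]]].
have [] := hX p; rewrite !p0 // ?prime_dvd_bin // !addr0 => e1 e2 e3.
elim/mpolyind: f => [|c m f _ _ IHf].
  by elim: (p) => //= q ->; rewrite /sigma raddf0.
have -> g h : iter p sigma (g + h) = iter p sigma g + iter p sigma h.
  by elim: (p) => //= q ->; rewrite sD.
rewrite IHf; congr (_ + _).
have -> : iter p sigma (c *: 'X_[m]) = c *: iter p sigma 'X_[m].
  by elim: (p) => //= q ->; rewrite /sigma linearZ.
congr (_ *: _); rewrite mpolyXE_id.
have iM g h : iter p sigma (g * h) = iter p sigma g * iter p sigma h.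
  by elim: (p) => //= q ->; rewrite /sigma rmorphM.
have i1 : iter p sigma 1 = 1.
  by elim: (p) => //= q ->; rewrite /sigma rmorph1.
rewrite (big_morph _ iM i1); apply: eq_bigr => i _.
have -> g q : iter p sigma (g ^+ q) = iter p sigma g ^+ q.
  by elim: q => [|q IHq]; rewrite ?expr0 // !exprS iM IHq.
congr (_ ^+ _); case: i => [[|[|[|//]]]] lti.
- by rewrite (_ : Ordinal lti = @Ordinal 3 0 isT) //; apply: val_inj.
- by rewrite (_ : Ordinal lti = @Ordinal 3 1 isT) //; apply: val_inj.
- by rewrite (_ : Ordinal lti = @Ordinal 3 2 isT) //; apply: val_inj.
Qed.

Lemma sigma_neq_id : sigma x2 <> x2.
Proof.
rewrite sigmaX2 => /eqP; rewrite -subr_eq0 [x2 + x3]addrC addrK => /eqP.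
by move/(congr1 (mcoeff U_(@Ordinal 3 2 isT)))/eqP; rewrite mcoeffX eqxx mcoeff0 oner_eq0.
Qed.
End V3.

Arguments basisS : clear implicits.
Arguments subalgA : clear implicits.
Arguments kerDelta : clear implicits.

(* Main.v *)
From HB Require Import structures.
Require Import Defs.
From mathcomp Require Import all_boot all_order all_algebra.
From mathcomp Require Import mpoly.
From mathcomp Require Import ring zify.
Set Implicit Arguments.
Unset Strict Implicit.
Unset Printing Implicit Defensive.
Import GRing.Theory.
Local Open Scope ring_scope.

(* The basis is detected modulo x3 and after inverting x3.
   Modulo x3, sigma is x1 |-> x1 + x2, a2 becomes x2^2 and a3 becomes monic of
   degree p in x1.  The element of S_n at position i has leading term
   u x2^e x1^a with u <> 0 and a < n <= p, and the 2n pairs (a, e mod 2) are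
   distinct, so S_n stays independent over A / x3 A.  Hence S_n is independent
   over A and its A-span is saturated with respect to x3.
   After inverting x3, every element is a polynomial in x2 over k[a2, x3, 1/x3];
   Delta is the difference operator x2 |-> x2 + x3, and a3 has degree 2p.  A
   nonzero element killed by Delta^n has degree d with d mod p < n.  The degrees
   of S_n are 0..n-1 and p..p+n-1, with leading coefficients that are units, so
   subtracting leading terms puts x3^m K_n inside the span, and saturation
   removes x3^m. *)

(** * Difference operators on univariate polynomials over a domain *)

Section DifferenceOperator.
Variable D : idomainType.
Implicit Types (y : D) (q : {poly D}).

(** This models [Delta] twice: with [y] equal to x2 in the variable x1 after reduction modulo x3,
    and with [y] equal to x3 in the variable x2 after inverting x3. *)
Definition dpoly y q : {poly D} := q \Po ('X + y%:P) - q.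

Lemma dpoly_coef y d q : (size q <= d.+1)%N ->
  (size (dpoly y q) <= d)%N /\ (dpoly y q)`_d.-1 = q`_d * y *+ d.
Proof.
elim: d q => [|d IHd] q.
  move/size1_polyC->; rewrite /dpoly comp_polyC subrr size_poly0.
  by rewrite coef0 mulr0n.
elim/poly_ind: q => [_|q c _ szq].
  by rewrite /dpoly comp_poly0 subrr size_poly0 !coef0 mul0r mul0rn.
have {}szq : (size q <= d.+1)%N.
  by move: szq; rewrite size_MXaddC; case: ifP => // /andP[/eqP-> _]; rewrite size_poly0.
have [szd cd] := IHd _ szq.
(* Twisted Leibniz rule for the factor ['X]: the shift of [q] is [dpoly y q + q], and the difference
   of ['X] is [y]. *)
have -> : dpoly y (q * 'X + c%:P) = dpoly y q * 'X + (dpoly y q + q) * y%:P.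
  rewrite /dpoly comp_polyD comp_polyM comp_polyX comp_polyC; ring.
move: (dpoly y q) szd cd => e szd cd; split.
  apply: (leq_trans (size_polyD _ _)); rewrite geq_max; apply/andP; split.
    by apply: (leq_trans (size_polyMleq _ _)); rewrite size_polyX addn2.
  rewrite mulrC mul_polyC; apply: (leq_trans (size_scale_leq _ _)).
  apply: (leq_trans (size_polyD _ _)); rewrite geq_max szq andbT.
  exact: leqW.
rewrite !(coefD, coefMX, coefMC, coefC) /= addr0.
rewrite (nth_default _ szd) add0r [RHS]mulrS [RHS]addrC; congr (_ + _).
by case: (d) cd => [|d0]; rewrite ?mulr0n.
Qed.

Lemma dpoly_lead y q d : size q = d.+2 -> d.+1%:R != 0 :> D -> y != 0 ->
  size (dpoly y q) = d.+1 /\ lead_coef (dpoly y q) = lead_coef q * y *+ d.+1.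
Proof.
move=> szq d0 y0.
have [szd cd] : _ /\ _ := @dpoly_coef y d.+1 q (eq_leq szq).
have lq0 : lead_coef q != 0 by rewrite lead_coef_eq0 -size_poly_eq0 szq.
have c0 : (dpoly y q)`_d != 0.
  rewrite [_`_d]cd -mulr_natr !mulf_neq0 //.
  by move: lq0; rewrite lead_coefE szq.
have sz : size (dpoly y q) = d.+1.
  by apply/eqP; rewrite eqn_leq szd ltnNge; apply: contra c0 => /leq_sizeP->.
by split=> //; rewrite !lead_coefE sz szq.
Qed.

(** As long as the degree is prime to p, one difference lowers it, and hence its residue modulo p,
    by exactly one. So at least [d %% p] differences can be taken before the leading term can
    vanish. *)
Lemma dpoly_iter_neq0 p y n q d : p \in [pchar D] -> y != 0 ->
  size q = d.+1 -> (n <= d %% p)%N -> iter n (dpoly y) q != 0.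
Proof.
move=> pchar_p y0; have p_gt0 := prime_gt0 (pcharf_prime pchar_p).
elim: n q d => [|n IHn] q [|d] szq; rewrite ?mod0n // => n_le.
- by rewrite -size_poly_eq0 szq.
- by rewrite -size_poly_eq0 szq.
have d0 : d.+1%:R != 0 :> D.
  by rewrite -(dvdn_pcharf pchar_p) /dvdn; case: (_ %% _)%N n_le.
have [szd _] := dpoly_lead szq d0 y0.
rewrite iterSr; apply: (IHn _ _ szd).
by move: n_le; rewrite modnS; case: ifP.
Qed.

End DifferenceOperator.

(** * Independence from distinct leading terms *)

Section LeadingTerms.

(** At the largest degree that occurs, the coefficient of the sum collects precisely the leading
    coefficients of the summands of that degree. *)
Lemma sum_max_lead (D : nzRingType) (I : finType) (P : pred I) (F : I -> {poly D}) :
  \sum_(i | P i) F i = 0 -> (exists2 i, P i & F i != 0) ->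
  exists2 N : nat, (exists2 i, P i & size (F i) = N.+1) &
    \sum_(i | P i && (size (F i) == N.+1)) lead_coef (F i) = 0.
Proof.
move=> sum0 [i0 Pi0 Fi0].
have [i Pi maxi] := arg_maxnP (fun i => size (F i)) Pi0.
have szi : size (F i) = (size (F i)).-1.+1.
  by rewrite prednK // (leq_trans _ (maxi i0 Pi0)) // size_poly_gt0.
exists (size (F i)).-1; first by exists i.
rewrite -szi; have /(congr1 (fun q : {poly D} => q`_(size (F i)).-1)) := sum0.
rewrite coef_sum coef0 => {2}<-.
rewrite [RHS](bigID (fun j => size (F j) == size (F i))) /= [X in _ + X]big1 ?addr0.
  by apply: eq_bigr => j /andP[_ /eqP e]; rewrite lead_coefE e.
move=> j /andP[Pj ne]; apply: nth_default.
by rewrite -ltnS -szi ltn_neqAle ne; apply: maxi.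
Qed.

(** Two uses of [sum_max_lead], in the outer variable and then on the leading coefficients, isolate
    a single summand, whose innermost leading coefficient would have to be zero. *)
Lemma sum_distinct_lead2 (k : nzRingType) (I : finType) (F : I -> {poly {poly k}}) :
    (forall i j, F i != 0 -> F j != 0 -> size (F i) = size (F j) ->
       size (lead_coef (F i)) = size (lead_coef (F j)) -> i = j) ->
  \sum_i F i = 0 -> forall i, F i = 0.
Proof.
move=> inj sum0 i; apply/eqP/negPn/negP => Fi0.
have [|N [j _ szj]] := sum_max_lead sum0; first by exists i.
have nz l : size (F l) = N.+1 -> F l != 0 by rewrite -size_poly_eq0 => ->.
case/sum_max_lead.
  by exists j; rewrite ?szj ?eqxx // lead_coef_eq0 nz.
move=> M [l /andP[_ /eqP szl] szl'].
rewrite (bigD1 l) /=; last by rewrite szl szl' !eqxx.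
rewrite big1 ?addr0 => [|m].
  by move/eqP; rewrite !lead_coef_eq0; apply/negP/nz.
case/andP=> /andP[/eqP szm /eqP szm'] /eqP[]; apply: inj; rewrite ?nz //.
  by rewrite szl szm.
by rewrite szl' szm'.
Qed.

End LeadingTerms.

(** * The operators [sigma] and [Delta], and the kernels of powers of [Delta] *)

Section Covariants.
Variable k : fieldType.
Local Notation R := {mpoly k[3]}.
Local Notation x1 := (x1 k).
Local Notation x2 := (x2 k).
Local Notation x3 := (x3 k).

Lemma mpoly3_ind (P : R -> Prop) :
  (forall c, P c%:MP) -> P x1 -> P x2 -> P x3 ->
  (forall f g, P f -> P g -> P (f + g)) ->
  (forall f g, P f -> P g -> P (f * g)) -> forall f, P f.
Proof.
move=> PC P1 P2 P3 PD PM; elim/mpolyind=> [|c m f _ _ Pf]; first by rewrite -mpolyC0.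
apply: PD => //; rewrite -mul_mpolyC; apply: (PM) => //; rewrite mpolyXE_id.
apply: (big_ind P) => // [|i _]; first by rewrite -mpolyC1.
have PX g e : P g -> P (g ^+ e).
  by move=> Pg; elim: e => [|e IHe]; rewrite ?exprS; [rewrite expr0 -mpolyC1 | apply: PM].
apply: PX; case: i => [[|[|[|//]]]] lti.
- by rewrite (_ : Ordinal lti = @Ordinal 3 0 isT) //; apply: val_inj.
- by rewrite (_ : Ordinal lti = @Ordinal 3 1 isT) //; apply: val_inj.
- by rewrite (_ : Ordinal lti = @Ordinal 3 2 isT) //; apply: val_inj.
Qed.

Lemma sigma_is_linear : linear (@sigma k).
Proof. by move=> a f g; rewrite /sigma linearP. Qed.

Lemma sigma_is_monoid_morphism : monoid_morphism (@sigma k).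
Proof. by split=> [|f g]; rewrite /sigma ?rmorph1 ?rmorphM. Qed.

HB.instance Definition _ := GRing.isLinear.Build k R R *:%R (@sigma k) sigma_is_linear.
HB.instance Definition _ :=
  GRing.isMonoidMorphism.Build R R (@sigma k) sigma_is_monoid_morphism.

Lemma x3_neq0 : x3 != 0.
Proof. by rewrite -msize_poly_eq0 msizeX. Qed.

Lemma sigmaC c : sigma c%:MP = c%:MP :> R.
Proof. exact: comp_mpolyC. Qed.

Lemma DeltaM (f g : R) : Delta (f * g) = Delta f * g + sigma f * Delta g.
Proof. by rewrite /Delta rmorphM /=; ring. Qed.

Lemma Delta_is_linear : linear (@Delta k).
Proof. by move=> a f g; rewrite /Delta linearP /=; rewrite scalerBr opprD addrACA. Qed.
HB.instance Definition _ := GRing.isLinear.Build k R R *:%R (@Delta k) Delta_is_linear.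

Lemma iter_DeltaD n (f g : R) :
  iter n (@Delta k) (f + g) = iter n (@Delta k) f + iter n (@Delta k) g.
Proof. by elim: n => //= n ->; rewrite raddfD. Qed.

Lemma iter_DeltaB n (f g : R) :
  iter n (@Delta k) (f - g) = iter n (@Delta k) f - iter n (@Delta k) g.
Proof. by elim: n => //= n ->; rewrite raddfB. Qed.

Lemma iter_Delta0 n : iter n (@Delta k) 0 = 0.
Proof. by elim: n => //= n ->; rewrite raddf0. Qed.

Lemma iter_Delta_sigma n (f : R) : iter n (@Delta k) (sigma f) = sigma (iter n (@Delta k) f).
Proof. by elim: n => //= n ->; rewrite /Delta raddfB. Qed.

Lemma iter_DeltaMl n (a f : R) : sigma a = a ->
  iter n (@Delta k) (a * f) = a * iter n (@Delta k) f.
Proof.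
move=> sa; elim: n => //= n ->.
by rewrite DeltaM {1}/Delta sa subrr mul0r add0r.
Qed.

Lemma kerDelta_le m n (f : R) : (m <= n)%N -> kerDelta k m f -> kerDelta k n f.
Proof.
by move=> /subnK<-; rewrite /kerDelta iterD => ->; rewrite iter_Delta0.
Qed.

(** By the twisted Leibniz rule, [Delta (f * g)] is a sum of two products in which one factor has
    moved one kernel down, [sigma] preserving kernels. The total [a + b] therefore drops, and the
    induction runs on a bound [s] for it. *)
Lemma kerDeltaM a b (f g : R) :
  kerDelta k a.+1 f -> kerDelta k b.+1 g -> kerDelta k (a + b).+1 (f * g).
Proof.
have [s le_s] : {s | (a + b <= s)%N} by exists (a + b)%N.
elim: s a b f g le_s => [|s IHs] a b f g le_s Kf Kg; rewrite /kerDelta.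
  case: a b Kf Kg le_s => // -[] // Kf Kg _.
  by rewrite addn0 /= DeltaM [Delta f]Kf [Delta g]Kg mulr0 mul0r addr0.
rewrite iterSr DeltaM iter_DeltaD.
have -> : iter (a + b) (@Delta k) (Delta f * g) = 0.
  case: a le_s Kf => [|a] le_s Kf; first by rewrite [Delta f]Kf mul0r iter_Delta0.
  by apply: (IHs a b) => //; rewrite /kerDelta -iterSr.
rewrite add0r.
case: b le_s Kg => [|b] le_s Kg; first by rewrite [Delta g]Kg mulr0 iter_Delta0.
rewrite addnS; apply: (IHs a b); rewrite ?/kerDelta -?iterSr //.
  by rewrite -ltnS -addnS.
by rewrite iter_Delta_sigma [iter _ _ _]Kf raddf0.
Qed.

Lemma kerDeltaX a e (f : R) : kerDelta k a.+1 f -> kerDelta k (a * e).+1 (f ^+ e).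
Proof.
move=> Kf; elim: e => [|e IHe]; first by rewrite muln0 expr0 /kerDelta /= /Delta rmorph1 subrr.
by rewrite exprS mulnS; apply: kerDeltaM.
Qed.

Lemma Delta_x1 : Delta x1 = x2. Proof. by rewrite /Delta sigmaX1 addrAC subrr add0r. Qed.
Lemma Delta_x2 : Delta x2 = x3. Proof. by rewrite /Delta sigmaX2 addrAC subrr add0r. Qed.
Lemma Delta_x3 : Delta x3 = 0. Proof. by rewrite /Delta sigmaX3 subrr. Qed.

(** Give x1 weight 2 and x2 weight 1, according to the kernels they lie in; weights add under
    products, and M_i has weight i. *)
Lemma kerDelta_Mpol i : kerDelta k i.+1 (Mpol k i).
Proof.
have K1 : kerDelta k 3 x1 by rewrite /kerDelta /= Delta_x1 Delta_x2 Delta_x3.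
have K2 : kerDelta k 2 x2 by rewrite /kerDelta /= Delta_x2 Delta_x3.
rewrite /Mpol; case: ifP => odd_i.
  have -> : (i.+1 = (2 * ((i - 1) %/ 2) + 1).+1)%N by lia.
  by apply: kerDeltaM => //; apply: kerDeltaX.
have -> : (i.+1 = (2 * (i %/ 2)).+1)%N by lia.
exact: kerDeltaX.
Qed.

(* {poly k} acts on R with 'X acting as sigma, so 'X - 1 acts as Delta. *)
Lemma iter_Delta_pchar p (f : R) : odd p -> p \in [pchar k] -> iter p (@Delta k) f = 0.
Proof.
move=> odd_p pchar_p.
pose act (P : {poly k}) g := \sum_(i < size P) P`_i *: iter i (@sigma k) g.
have actE N (P : {poly k}) g : (size P <= N)%N -> act P g = \sum_(i < N) P`_i *: iter i (@sigma k) g.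
  move=> le_N; rewrite /act (big_ord_widen _ (fun i => P`_i *: iter i (@sigma k) g) le_N).
  rewrite [RHS](bigID (fun i : 'I_N => i < size P)%N) /= [X in _ + X]big1 ?addr0 // => i.
  by rewrite -leqNgt => le_i; rewrite nth_default // scale0r.
have actB P Q g : act (P - Q) g = act P g - act Q g.
  pose N := maxn (size P) (size Q).
  rewrite !(@actE N) ?leq_maxl ?leq_maxr //; last first.
    by rewrite (leq_trans (size_polyD _ _)) // size_polyN.
  by rewrite -sumrB; apply: eq_bigr => i _; rewrite coefB scalerBl.
have actX (P : {poly k}) g : act (P * 'X) g = sigma (act P g).
  rewrite (@actE (size P).+1); last first.
    by rewrite (leq_trans (size_polyMleq _ _)) // size_polyX addn2.
  rewrite big_ord_recl coefMX eqxx scale0r add0r /act raddf_sum.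
  by apply: eq_bigr => i _; rewrite coefMX /= linearZ.
have actDelta n : act (('X - 1) ^+ n) f = iter n (@Delta k) f.
  elim: n => [|n IHn]; first by rewrite expr0 /act size_poly1 big_ord1 coefC scale1r.
  by rewrite exprSr mulrBr mulr1 actB actX IHn.
have actXn n : act ('X^n) f = iter n (@sigma k) f.
  elim: n => [|n IHn]; first by rewrite expr0 /act size_poly1 big_ord1 coefC scale1r.
  by rewrite exprSr actX IHn.
have pchar_poly : p \in [pchar {poly k}] by rewrite pchar_poly.
rewrite -actDelta.
(* Frobenius. The constant 1 is written ['X^0] so that both terms act as iterates of [sigma], and
   these agree because [sigma] has p-th power the identity. *)
have -> : ('X - 1) ^+ p = 'X^p - 'X^0 :> {poly k}.
  rewrite -(pFrobenius_autE pchar_poly) pFrobenius_autB_comm; last exact: mulrC.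
  by rewrite !pFrobenius_autE expr1n expr0.
by rewrite actB !actXn /= sigma_iter_char // subrr.
Qed.

End Covariants.

(** * Independence of the basis modulo x3 *)

Section ReductionModX3.
Variables (k : fieldType) (p : nat).
Hypotheses (odd_p : odd p) (pchar_p : p \in [pchar k]).
Local Notation R := {mpoly k[3]}.
Local Notation x1 := (x1 k).
Local Notation x2 := (x2 k).
Local Notation x3 := (x3 k).
Local Notation A := (subalgA k p).

Lemma subalgA_a1 : A (a1 k). Proof. by apply: SubalgGen; constructor 1. Qed.
Lemma subalgA_a2 : A (a2 k). Proof. by apply: SubalgGen; constructor 2. Qed.
Lemma subalgA_a3 : A (a3 k p). Proof. by apply: SubalgGen; constructor 3. Qed.

Lemma subalgAC c : A c%:MP.
Proof. by rewrite -[c%:MP]mulr1 mul_mpolyC; apply/SubalgScal/SubalgOne. Qed.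

Lemma subalgA0 : A 0.
Proof. by rewrite -mpolyC0; apply: subalgAC. Qed.

Lemma subalgAN a : A a -> A (- a).
Proof. by rewrite -scaleN1r; apply: SubalgScal. Qed.

Lemma subalgAX a e : A a -> A (a ^+ e).
Proof.
by move=> Aa; elim: e => [|e IHe]; rewrite ?exprS; [apply: SubalgOne | apply: SubalgMul].
Qed.

(** [sigma] permutes the factors of the product cyclically, since its p-th iterate fixes x1. *)
Lemma sigma_a3 : sigma (a3 k p) = a3 k p.
Proof.
have := prime_gt0 (pcharf_prime pchar_p).
have := sigma_iter_char x1 odd_p pchar_p; rewrite /a3 rmorph_prod /=.
case: (p) => // q sq _; rewrite big_ord_recr [RHS]big_ord_recl /= mulrC.
by rewrite -[sigma _]/(iter q.+1 (@sigma k) x1) sq.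
Qed.

Lemma subalgA_sigma a : A a -> sigma a = a.
Proof.
elim=> [f [->|->|->]||f g _ sf _ sg|f g _ sf _ sg|c f _ sf].
- exact: sigmaX3.
- rewrite /a2 !(rmorphB, rmorphM, rmorphXn, rmorph_nat) /= sigmaX1 sigmaX2 sigmaX3.
  ring.
- exact: sigma_a3.
- exact: rmorph1.
- by rewrite rmorphD /= sf sg.
- by rewrite rmorphM /= sf sg.
- by rewrite linearZ /= sf.
Qed.

(** Reduction modulo x3: the outer variable is x1 and the inner one is x2, so degrees are compared
    first in x1. *)
Definition theta : R -> {poly {poly k}} :=
  mmap (@polyC {poly k} \o @polyC k) (tnth [tuple 'X; 'X%:P; 0]).

HB.instance Definition _ := GRing.RMorphism.on theta.

Lemma thetaC c : theta c%:MP = c%:P%:P. Proof. exact: mmapC. Qed.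
Lemma theta_x1 : theta x1 = 'X. Proof. by rewrite /theta mmapX mmap1U. Qed.
Lemma theta_x2 : theta x2 = 'X%:P. Proof. by rewrite /theta mmapX mmap1U. Qed.
Lemma theta_x3 : theta x3 = 0. Proof. by rewrite /theta mmapX mmap1U. Qed.

Lemma theta_sigma f : theta (sigma f) = theta f \Po ('X + 'X%:P).
Proof.
move: f; apply: mpoly3_ind => [c||||f g IHf IHg|f g IHf IHg].
- by rewrite sigmaC thetaC comp_polyC.
- by rewrite sigmaX1 rmorphD /= theta_x1 theta_x2 comp_polyX.
- by rewrite sigmaX2 rmorphD /= theta_x2 theta_x3 addr0 comp_polyC.
- by rewrite sigmaX3 theta_x3 comp_poly0.
- by rewrite !rmorphD /= IHf IHg.
- by rewrite !rmorphM /= IHf IHg.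
Qed.

Lemma theta_Delta f : theta (Delta f) = dpoly 'X (theta f).
Proof. by rewrite rmorphB /= theta_sigma. Qed.

Definition theta_lead f a e := exists2 u : k, u != 0 &
  size (theta f) = a.+1 /\ lead_coef (theta f) = u *: 'X^e.

Lemma theta_leadM f g a b d e :
  theta_lead f a d -> theta_lead g b e -> theta_lead (f * g) (a + b) (d + e).
Proof.
move=> [u u0 [szf lf]] [v v0 [szg lg]]; exists (u * v); first exact: mulf_neq0.
rewrite rmorphM /= size_mul -?size_poly_eq0 ?szf ?szg // lead_coefM lf lg.
by rewrite -scalerAl -scalerAr scalerA -exprD addnS.
Qed.

Lemma theta_lead_x1 e : theta_lead (x1 ^+ e) e 0.
Proof.
exists 1; rewrite ?oner_eq0 // rmorphXn /= theta_x1 size_polyXn lead_coefXn.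
by rewrite expr0 scale1r.
Qed.

Lemma theta_lead_x2 : theta_lead x2 0 1.
Proof.
by exists 1; rewrite ?oner_eq0 // theta_x2 size_polyC polyX_eq0 lead_coefC scale1r.
Qed.

Lemma theta_lead_Delta f a e :
  theta_lead f a.+1 e -> ~~ (p %| a.+1)%N -> theta_lead (Delta f) a e.+1.
Proof.
move=> [u u0 [szf lf]] ndvd; exists (u * a.+1%:R).
  by rewrite mulf_neq0 // -(dvdn_pcharf pchar_p).
rewrite theta_Delta; have [||-> ->] := @dpoly_lead _ 'X _ _ szf.
- by rewrite -polyC_natr polyC_eq0 -(dvdn_pcharf pchar_p).
- by rewrite polyX_eq0.
by split=> //; rewrite lf -scalerAl -exprSr -scaler_nat scalerA mulrC.
Qed.

(** The bound on [m] keeps the x1-degrees a, a - 1, ..., a - m + 1 that get differenced prime to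
    p. *)
Lemma theta_lead_iter_Delta m f a e : (m <= a %% p)%N ->
  theta_lead f a e -> theta_lead (iter m (@Delta k) f) (a - m) (e + m).
Proof.
have p_gt0 := prime_gt0 (pcharf_prime pchar_p).
elim: m f a e => [|m IHm] f a e le_m Lf; first by rewrite subn0 addn0.
case: a le_m Lf => [|a]; first by rewrite mod0n.
rewrite iterSr subSS addnS -addSn => le_m Lf; apply: IHm.
  by move: le_m; rewrite modnS; case: ifP.
by apply: theta_lead_Delta => //; apply/negP => /eqP e0; rewrite e0 in le_m.
Qed.

Lemma theta_lead_Mpol j : theta_lead (Mpol k j) j./2 (odd j).
Proof.
rewrite /Mpol; case: ifP => odd_j; last by rewrite divn2; apply: theta_lead_x1.
have -> : j./2 = ((j - 1) %/ 2 + 0)%N by lia.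
exact: (theta_leadM (theta_lead_x1 _) theta_lead_x2).
Qed.

(** For even j > 0 the exponent p - j/2 is prime to p, so [Delta] turns the leading term into a unit
    times x1^(p-j/2-1) x2. At j = 0 that exponent would be p, and P_0 is directly the monomial
    continuing this pattern. *)
Lemma theta_lead_Ppol j : (j < p)%N ->
  theta_lead (Ppol k p j) (p - 1 - j./2) (~~ odd j).
Proof.
move=> lt_j; rewrite /Ppol; case: eqP => [->|/eqP j0] /=.
  have -> : (p - 1 - 0 = (p - 1) + 0)%N by lia.
  exact: (theta_leadM (theta_lead_x1 _) theta_lead_x2).
case: ifP => odd_j /=.
  have -> : (p - 1 - j./2 = p - (j + 1) %/ 2)%N by lia.
  exact: theta_lead_x1.
have e : (p - j %/ 2 = (p - 1 - j./2).+1)%N by lia.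
rewrite e; apply: theta_lead_Delta; first exact: theta_lead_x1.
by rewrite gtnNdvd //; lia.
Qed.

Definition theta_deg n (i : 'I_n + 'I_n) : nat :=
  match i with inl j => j./2 | inr j => n - 1 - j./2 end.

Definition theta_exp n (i : 'I_n + 'I_n) : nat :=
  match i with inl j => odd j | inr j => ~~ odd j + (p - n) end.

Lemma theta_lead_basisS n (i : 'I_n + 'I_n) : (n <= p)%N ->
  theta_lead (basisS k p n i) (theta_deg i) (theta_exp i).
Proof.
move=> le_n; case: i => j /=; first exact: theta_lead_Mpol.
have lt_j := ltn_ord j.
have -> : (n - 1 - j./2 = (p - 1 - j./2) - (p - n))%N by lia.
apply: theta_lead_iter_Delta; last by apply: theta_lead_Ppol; lia.
by rewrite modn_small; lia.
Qed.

Lemma theta_deg_lt n (i : 'I_n + 'I_n) : (theta_deg i < n)%N.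
Proof. by case: i => j /=; have := ltn_ord j; lia. Qed.

(** Within one half, the index is recovered from its half and its parity. Across the halves, equal
    degrees give i/2 + j/2 = n - 1 (rounded down), which forces i = j = n - 1 even; since p is odd,
    equal parities require i + j and n to have the same parity, a contradiction. *)
Lemma theta_deg_exp_inj n (i j : 'I_n + 'I_n) : (n <= p)%N ->
  theta_deg i = theta_deg j -> odd (theta_exp i) = odd (theta_exp j) -> i = j.
Proof.
move=> le_n; case: i j => [i|i] [j|j] /=;
  rewrite ?oddD ?(oddB le_n) ?odd_p ?oddb => e1 e2; have := ltn_ord i; have := ltn_ord j.
- by move=> *; congr inl; apply: val_inj => /=; lia.
- by lia.
- by lia.
- by move=> *; congr inr; apply: val_inj => /=; lia.
Qed.

(** The value h(a2, a3), with a2 for the inner variable and a3 for the outer one. *)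
Definition evalA (h : {poly {poly k}}) : R := (map_poly (horner_alg (a2 k)) h).[a3 k p].

Lemma subalgA_evalA h : A (evalA h).
Proof.
have Asum m (F : 'I_m -> R) : (forall i, A (F i)) -> A (\sum_(i < m) F i).
  by move=> AF; apply: big_ind => //; [apply: subalgA0 | apply: SubalgAdd].
rewrite /evalA horner_poly; apply: (Asum) => i; apply: SubalgMul; last first.
  exact/subalgAX/subalgA_a3.
rewrite /horner_alg /= /horner_morph horner_poly; apply: Asum => j; apply: SubalgMul.
  exact/SubalgScal/SubalgOne.
exact/subalgAX/subalgA_a2.
Qed.

(** The remainder is x3 times an element of A, not merely of the polynomial ring, so that division
    by x3 can be repeated. *)
Lemma subalgA_mod_x3 a : A a -> exists h a', A a' /\ a = evalA h + x3 * a'.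
Proof.
elim=> [f [->|->|->]||f g _ [h [f' [Af ->]]] _ [l [g' [Ag ->]]]
       |f g _ [h [f' [Af ->]]] _ [l [g' [Ag ->]]]|c f _ [h [f' [Af ->]]]].
- by exists 0, 1; split; [apply: SubalgOne | rewrite /evalA rmorph0 horner0 add0r mulr1].
- exists 'X%:P, 0; split; first exact: subalgA0.
  by rewrite /evalA map_polyC hornerC mulr0 addr0 /= horner_algX.
- exists 'X, 0; split; first exact: subalgA0.
  by rewrite /evalA map_polyX hornerX mulr0 addr0.
- exists 1, 0; split; first exact: subalgA0.
  by rewrite /evalA rmorph1 hornerC mulr0 addr0.
- exists (h + l), (f' + g'); split; first exact: SubalgAdd.
  by rewrite /evalA rmorphD hornerD /=; ring.
- exists (h * l), (evalA h * g' + f' * evalA l + x3 * (f' * g')); split.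
    have Ah := subalgA_evalA h; have Al := subalgA_evalA l.
    apply: SubalgAdd; first by apply: SubalgAdd; apply: SubalgMul.
    by apply: SubalgMul; [apply: subalgA_a1 | apply: SubalgMul].
  by rewrite /evalA rmorphM hornerM /=; ring.
- exists (c%:P%:P * h), (c *: f'); split; first exact: SubalgScal.
  rewrite /evalA rmorphM hornerM /= map_polyC hornerC /= horner_algC scalerDr.
  by rewrite -scalerAl mul1r -scalerAr.
Qed.

Lemma theta_evalA h :
  theta (evalA h) = map_poly (comp_poly 'X^2) h \Po theta (a3 k p).
Proof.
rewrite /evalA -horner_map -map_poly_comp [RHS]/comp_poly -map_poly_comp.
congr (_.[_]); apply: eq_map_poly => q /=.
elim/poly_ind: q => [|q c IHq]; first by rewrite !rmorph0.
rewrite !(rmorphD, rmorphM) /= horner_algX horner_algC IHq comp_polyX comp_polyC.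
rewrite -mul_mpolyC mulr1 thetaC; congr (_ * _ + _).
rewrite /a2 !(rmorphB, rmorphM, rmorphXn) /= theta_x2 theta_x3.
by rewrite !mulr0 !subr0.
Qed.

Lemma theta_a3 : size (theta (a3 k p)) = p.+1 /\ lead_coef (theta (a3 k p)) = 1.
Proof.
have theta_iter i : theta (iter i (@sigma k) x1) = 'X - (- ('X *+ i))%:P.
  elim: i => [|i IHi] /=; first by rewrite mulr0n oppr0 subr0 theta_x1.
  rewrite theta_sigma IHi comp_polyB comp_polyX comp_polyC !polyCN !opprK -addrA.
  by rewrite -polyCD -mulrS.
rewrite /a3 rmorph_prod (eq_bigr _ (fun (i : 'I_p) _ => theta_iter i)) size_prod_XsubC.
split; first by rewrite -sum1_size sum1_card card_ord.
apply/monicP; apply: monic_prod_XsubC.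
Qed.

(** Modulo x3, a3 is monic of degree p in x1 and a2 is x2^2. Hence h(a2, a3) has x1-degree a
    multiple of p, with leading coefficient of even degree in x2. *)
Lemma theta_evalA_lead h : h != 0 -> exists D M,
  size (theta (evalA h)) = (D * p).+1 /\ size (lead_coef (theta (evalA h))) = (M * 2).+1.
Proof.
move=> h0; have [sz3 l3] := theta_a3.
have p_gt0 := prime_gt0 (pcharf_prime pchar_p).
have size_comp (D : idomainType) (f g : {poly D}) :
    f != 0 -> (1 < size g)%N -> size (f \Po g) = ((size f).-1 * (size g).-1).+1.
  by move=> f0 gt1; rewrite -size_comp_poly prednK // size_poly_gt0 comp_poly_eq0.
have inj2 : injective (comp_poly ('X^2 : {poly k})).
  move=> f g /eqP; rewrite -subr_eq0 -rmorphB /= comp_poly_eq0 ?size_polyXn //.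
  by rewrite subr_eq0 => /eqP.
have szX2 : size ('X^2 : {poly k}) = 3 by rewrite size_polyXn.
have h20 : map_poly (comp_poly 'X^2) h != 0.
  by rewrite -size_poly_eq0 size_map_inj_poly ?rmorph0 // size_poly_eq0.
exists (size h).-1, (size (lead_coef h)).-1; rewrite theta_evalA; split.
  by rewrite size_comp // sz3 ?ltnS // size_map_inj_poly ?rmorph0.
rewrite lead_coef_comp ?sz3 ?ltnS // l3 expr1n mulr1 lead_coef_map_inj ?rmorph0 //.
by rewrite size_comp ?szX2 // lead_coef_eq0.
Qed.

Lemma basisS_indep_mod_x3 n (c : 'I_n + 'I_n -> R) : (n <= p)%N ->
  (forall i, A (c i)) -> theta (\sum_i c i * basisS k p n i) = 0 ->
  exists2 c' : 'I_n + 'I_n -> R, (forall i, A (c' i)) & forall i, c i = x3 * c' i.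
Proof.
move=> le_n Ac sum0.
have [h hP] := fin_all_exists (fun i => subalgA_mod_x3 (Ac i)).
have [c' {}hP] := fin_all_exists hP.
exists c' => i; first by case: (hP i).
have thetac j : theta (c j) = theta (evalA (h j)).
  by case: (hP j) => _ ->; rewrite rmorphD rmorphM /= theta_x3 mul0r addr0.
pose F j := theta (evalA (h j)) * theta (basisS k p n j).
have F_lead j : F j != 0 -> exists D M, size (F j) = (D * p + theta_deg j).+1 /\
    size (lead_coef (F j)) = (M * 2 + theta_exp j).+1.
  rewrite mulf_eq0 => /norP[e0 s0].
  have h0 : h j != 0.
    by apply: contraNneq e0 => ->; rewrite /evalA rmorph0 horner0 rmorph0.
  have [D [M [szD szM]]] := theta_evalA_lead h0.
  have [u u0 [szs ls]] := theta_lead_basisS j le_n; exists D, M.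
  rewrite size_mul // szD szs addSn addnS; split=> //.
  rewrite lead_coefM size_mul ?lead_coef_eq0 // szM ls size_scale // size_polyXn.
  by rewrite addSn addnS.
have F0 j : F j = 0.
  move: j; apply: sum_distinct_lead2 => [j l Fj Fl|]; last first.
    by rewrite -[RHS]sum0 rmorph_sum; apply: eq_bigr => j _; rewrite rmorphM /= thetac.
  have [D [M [-> ->]]] := F_lead j Fj; have [D' [M' [-> ->]]] := F_lead l Fl.
  (* The coefficient from A contributes a multiple of p to the x1-degree and an even number to the
     x2-degree, so the residues modulo p and 2 depend only on the basis element; [theta_deg] is
     below p and survives intact. *)
  move=> [/(congr1 (modn^~ p))]; rewrite !modnMDl.
  have lt_p := leq_trans (theta_deg_lt _) le_n.
  rewrite !modn_small // => eq_deg [/(congr1 odd)].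
  by rewrite !oddD !oddM !andbF; apply: theta_deg_exp_inj.
have h0 : h i = 0.
  apply/eqP/negPn/negP => /theta_evalA_lead[D [M [szD _]]].
  have [u u0 [szs _]] := theta_lead_basisS i le_n.
  by move/eqP: (F0 i); rewrite mulf_eq0 -!size_poly_eq0 szD szs.
by case: (hP i) => _ ->; rewrite h0 /evalA rmorph0 horner0 add0r.
Qed.

End ReductionModX3.

(** * Degrees in x2 after inverting x3 *)

Section LocalizationAtX3.
Variables (k : fieldType) (p : nat).
Hypotheses (odd_p : odd p) (pchar_p : p \in [pchar k]).
Local Notation R := {mpoly k[3]}.
Local Notation x1 := (x1 k).
Local Notation x2 := (x2 k).
Local Notation x3 := (x3 k).
Local Notation A := (subalgA k p).

(* The flow t |-> sigma^(2 t): doubling the time avoids dividing by 2. *)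
Definition psi : R -> {poly R} :=
  mmap (@polyC R \o @mpolyC 3 k)
    (tnth [tuple x1%:P + x2%:P * ('X *+ 2) + x3%:P * ('X ^+ 2 *+ 2 - 'X);
                 x2%:P + x3%:P * ('X *+ 2); x3%:P]).

HB.instance Definition _ := GRing.RMorphism.on psi.

Lemma psiC c : psi c%:MP = c%:MP%:P. Proof. exact: mmapC. Qed.
Lemma psi_x1 : psi x1 = x1%:P + x2%:P * ('X *+ 2) + x3%:P * ('X ^+ 2 *+ 2 - 'X).
Proof. by rewrite /psi mmapX mmap1U. Qed.
Lemma psi_x2 : psi x2 = x2%:P + x3%:P * ('X *+ 2).
Proof. by rewrite /psi mmapX mmap1U. Qed.
Lemma psi_x3 : psi x3 = x3%:P. Proof. by rewrite /psi mmapX mmap1U. Qed.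

Lemma natr2_neq0 : 2%:R != 0 :> k.
Proof.
have p_prime := pcharf_prime pchar_p.
by rewrite -(dvdn_pcharf pchar_p) dvdn_prime2 //; apply: contraTneq odd_p => ->.
Qed.

Lemma size_psi_x2 : size (psi x2) = 2.
Proof.
have c0 : x3 *+ 2 != 0.
  by rewrite -scaler_nat scaler_eq0 negb_or natr2_neq0 x3_neq0.
have -> : psi x2 = 'X * (x3 *+ 2)%:P + x2%:P by rewrite psi_x2 polyCMn; ring.
by rewrite mulrC mul_polyC -[_ *: 'X]mul_polyC size_MXaddC polyC_eq0 (negPf c0) size_polyC c0.
Qed.

(** This stands in for membership in k[a2, x3]: lying in A keeps combinations inside the span, and
    being constant along the flow makes x2 transcendental over such elements. *)
Definition flow_fixed a := A a /\ psi a = a%:P.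

Lemma flow_fixed_sigma a : flow_fixed a -> sigma a = a.
Proof. by case=> Aa _; apply: subalgA_sigma Aa. Qed.

Lemma flow_fixedC c : flow_fixed c%:MP.
Proof. by split; [apply: subalgAC | apply: psiC]. Qed.

Lemma flow_fixed_x3 : flow_fixed x3.
Proof. by split; [apply: subalgA_a1 | apply: psi_x3]. Qed.

Lemma flow_fixed_a2 : flow_fixed (a2 k).
Proof.
split; first exact: subalgA_a2.
rewrite /a2 !(rmorphB, rmorphM, rmorphXn, rmorph_nat) /= psi_x1 psi_x2 psi_x3.
ring.
Qed.

Lemma flow_fixed0 : flow_fixed 0.
Proof. by rewrite -mpolyC0; apply: flow_fixedC. Qed.

Lemma flow_fixedD a b : flow_fixed a -> flow_fixed b -> flow_fixed (a + b).
Proof.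
move=> [Aa ea] [Ab eb]; split; first exact: SubalgAdd.
by rewrite rmorphD /= ea eb polyCD.
Qed.

Lemma flow_fixedM a b : flow_fixed a -> flow_fixed b -> flow_fixed (a * b).
Proof.
move=> [Aa ea] [Ab eb]; split; first exact: SubalgMul.
by rewrite rmorphM /= ea eb polyCM.
Qed.

Lemma flow_fixedN a : flow_fixed a -> flow_fixed (- a).
Proof. by case=> Aa ea; split; [apply: subalgAN | rewrite rmorphN /= ea polyCN]. Qed.

Lemma flow_fixed_sum (I : Type) (r : seq I) (P : pred I) (F : I -> R) :
  (forall i, P i -> flow_fixed (F i)) -> flow_fixed (\sum_(i <- r | P i) F i).
Proof. by move=> PF; apply: big_ind => //; [apply: flow_fixed0 | apply: flow_fixedD]. Qed.

Definition flow_poly (q : {poly R}) := forall i, flow_fixed q`_i.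

Lemma flow_polyC c : flow_fixed c -> flow_poly c%:P.
Proof. by move=> Cc i; rewrite coefC; case: ifP => // _; apply: flow_fixed0. Qed.

Lemma flow_polyX : flow_poly 'X.
Proof. by move=> i; rewrite coefX -mpolyC_nat; apply: flow_fixedC. Qed.

Lemma flow_polyD f g : flow_poly f -> flow_poly g -> flow_poly (f + g).
Proof. by move=> Cf Cg i; rewrite coefD; apply: flow_fixedD. Qed.

Lemma flow_polyN f : flow_poly f -> flow_poly (- f).
Proof. by move=> Cf i; rewrite coefN; apply: flow_fixedN. Qed.

Lemma flow_polyB f g : flow_poly f -> flow_poly g -> flow_poly (f - g).
Proof. by move=> Cf Cg; apply/flow_polyD/flow_polyN. Qed.

Lemma flow_polyM f g : flow_poly f -> flow_poly g -> flow_poly (f * g).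
Proof. by move=> Cf Cg i; rewrite coefM; apply: flow_fixed_sum => j _; apply: flow_fixedM. Qed.

Lemma flow_polyXn f e : flow_poly f -> flow_poly (f ^+ e).
Proof.
move=> Cf; elim: e => [|e IHe]; last by rewrite exprS; apply: flow_polyM.
by rewrite expr0 -[1]/(1%:P) -mpolyC1; apply/flow_polyC/flow_fixedC.
Qed.

Lemma flow_poly_comp f g : flow_poly f -> flow_poly g -> flow_poly (f \Po g).
Proof.
move=> Cf Cg i; rewrite comp_polyE coef_sum; apply: flow_fixed_sum => j _.
by rewrite coefZ; apply: flow_fixedM => //; apply: flow_polyXn.
Qed.

Lemma flow_poly_shift f : flow_poly f -> flow_poly (f \Po ('X + x3%:P)).
Proof.
move=> Cf; apply: flow_poly_comp => //; apply: flow_polyD; first exact: flow_polyX.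
exact/flow_polyC/flow_fixed_x3.
Qed.

Lemma flow_poly_dpoly f : flow_poly f -> flow_poly (dpoly x3 f).
Proof. by move=> Cf; apply: flow_polyB => //; apply: flow_poly_shift. Qed.

Lemma sigma_flow_poly q : flow_poly q -> sigma q.[x2] = (q \Po ('X + x3%:P)).[x2].
Proof.
move=> Cq; rewrite -horner_map /= sigmaX2 horner_comp hornerD hornerX hornerC.
by congr (_.[_]); apply/polyP => i; rewrite coef_map /= flow_fixed_sigma.
Qed.

Lemma Delta_flow_poly q : flow_poly q -> Delta q.[x2] = (dpoly x3 q).[x2].
Proof. by move=> Cq; rewrite /Delta sigma_flow_poly // /dpoly hornerD hornerN. Qed.

(** Applying [psi] fixes the coefficients and sends x2 to a polynomial of degree one in the flow
    parameter, its slope 2 x3 being nonzero; substitution of such a polynomial is injective. *)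
Lemma flow_poly_inj q : flow_poly q -> q.[x2] = 0 -> q = 0.
Proof.
move=> Cq /(congr1 psi)/eqP; rewrite rmorph0 -horner_map /=.
have -> : map_poly psi q = map_poly polyC q.
  by apply/polyP => i; rewrite !coef_map /=; case: (Cq i).
by rewrite -[_.[_]]/(q \Po psi x2) comp_poly2_eq0 ?size_psi_x2 // => /eqP.
Qed.

(* By the definition of a2, this is x3 x1 as a polynomial in x2 with flow-fixed
   coefficients; hence x2 generates R over them once x3 is inverted. *)
Definition half_x1x3 : {poly R} :=
  (2%:R^-1)%:MP%:P * ('X ^+ 2 - x3%:P * 'X - (a2 k)%:P).

Lemma flow_poly_half_x1x3 : flow_poly half_x1x3.
Proof.
apply: flow_polyM; first exact/flow_polyC/flow_fixedC.
apply: flow_polyB; last exact/flow_polyC/flow_fixed_a2.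
apply: flow_polyB; first exact/flow_polyXn/flow_polyX.
by apply: flow_polyM; [apply/flow_polyC/flow_fixed_x3 | apply: flow_polyX].
Qed.

Lemma half_x1x3E : half_x1x3.[x2] = x3 * x1.
Proof.
rewrite /half_x1x3 !hornerE /a2.
have -> : x2 ^+ 2 - x3 * x2 - (x2 ^+ 2 - 2%:R * x1 * x3 - x2 * x3) = 2%:R * (x3 * x1) :> R.
  by ring.
have e2 : 2%:R = 2%:R%:MP :> R by rewrite mpolyC_nat.
by rewrite !mulrA e2 -mpolyCM mulVf ?natr2_neq0 // mpolyC1 mul1r.
Qed.

Lemma flow_poly_repr f : exists m q, flow_poly q /\ x3 ^+ m * f = q.[x2].
Proof.
move: f; apply: mpoly3_ind => [c||||f g|f g].
- exists 0%N, c%:MP%:P; split; first exact/flow_polyC/flow_fixedC.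
  by rewrite hornerC expr0 mul1r.
- exists 1%N, half_x1x3; split; first exact: flow_poly_half_x1x3.
  by rewrite half_x1x3E expr1.
- exists 0%N, 'X; split; first exact: flow_polyX.
  by rewrite hornerX expr0 mul1r.
- exists 0%N, x3%:P; split; first exact/flow_polyC/flow_fixed_x3.
  by rewrite hornerC expr0 mul1r.
- move=> [m [q [Cq eq]]] [n [r [Cr er]]].
  have Cx := flow_polyXn _ (flow_polyC flow_fixed_x3).
  exists (m + n)%N, (x3%:P ^+ n * q + x3%:P ^+ m * r); split.
    by apply: flow_polyD; apply: flow_polyM.
  by rewrite !hornerE -eq -er exprD; ring.
- move=> [m [q [Cq eq]]] [n [r [Cr er]]]; exists (m + n)%N, (q * r); split.
    exact: flow_polyM.
  by rewrite hornerM -eq -er exprD; ring.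
Qed.

(** Degree d in x2 once x3 is inverted, with a leading coefficient that becomes a unit there; [m]
    clears denominators. *)
Definition flow_lead f d := exists m q r (u : k),
  [/\ flow_poly q, x3 ^+ m * f = q.[x2], size q = d.+1, u != 0 &
      lead_coef q = u *: x3 ^+ r].

Lemma flow_leadM f g d e : flow_lead f d -> flow_lead g e -> flow_lead (f * g) (d + e).
Proof.
move=> [m [q [r [u [Cq eq szq u0 lq]]]]] [n [s [t [v [Cs es szs v0 ls]]]]].
exists (m + n)%N, (q * s), (r + t)%N, (u * v); split.
- exact: flow_polyM.
- by rewrite hornerM -eq -es exprD; ring.
- by rewrite size_mul -?size_poly_eq0 ?szq ?szs // addnS.
- exact: mulf_neq0.
- by rewrite lead_coefM lq ls -scalerAl -scalerAr scalerA exprD.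
Qed.

Lemma flow_lead1 : flow_lead 1 0.
Proof.
exists 0%N, 1, 0%N, 1; rewrite size_poly1 lead_coef1 expr0 scale1r mul1r hornerC oner_neq0.
by split=> //; rewrite -[1]/(1%:P) -mpolyC1; apply/flow_polyC/flow_fixedC.
Qed.

Lemma flow_leadX f d e : flow_lead f d -> flow_lead (f ^+ e) (d * e).
Proof.
move=> Lf; elim: e => [|e IHe]; first by rewrite muln0; apply: flow_lead1.
by rewrite exprS mulnS; apply: flow_leadM.
Qed.

Lemma flow_lead_x2 : flow_lead x2 1.
Proof.
exists 0%N, 'X, 0%N, 1; rewrite size_polyX lead_coefX expr0 scale1r mul1r hornerX oner_neq0.
by split=> //; apply: flow_polyX.
Qed.

Lemma flow_lead_x1 : flow_lead x1 2.
Proof.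
pose tail : {poly R} := - (x3%:P * 'X) - (a2 k)%:P.
have szl : (size tail < size ('X^2 : {poly R}))%N.
  rewrite size_polyXn ltnS (leq_trans (size_polyD _ _)) // geq_max !size_polyN.
  rewrite (leq_trans (size_polyC_leq1 _)) // andbT.
  by rewrite mul_polyC (leq_trans (size_scale_leq _ _)) // size_polyX.
have c0 : (2%:R^-1)%:MP != 0 :> R by rewrite mpolyC_eq0 invr_eq0 natr2_neq0.
have halfE : half_x1x3 = (2%:R^-1)%:MP *: ('X^2 + tail).
  by rewrite /half_x1x3 mul_polyC -addrA.
exists 1%N, half_x1x3, 0%N, (2%:R^-1); split.
- exact: flow_poly_half_x1x3.
- by rewrite half_x1x3E expr1.
- by rewrite halfE size_scale // size_polyDl // size_polyXn.
- by rewrite invr_eq0 natr2_neq0.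
- by rewrite halfE lead_coefZ lead_coefDl // lead_coefXn expr0 mul_mpolyC.
Qed.

Lemma flow_lead_sigma f d : flow_lead f d -> flow_lead (sigma f) d.
Proof.
move=> [m [q [r [u [Cq eq szq u0 lq]]]]].
exists m, (q \Po ('X + x3%:P)), r, u; split=> //.
- exact: flow_poly_shift.
- by rewrite -sigma_flow_poly // -eq rmorphM rmorphXn /= sigmaX3.
- by rewrite size_comp_poly2 // size_XaddC.
- by rewrite lead_coef_comp ?size_XaddC // lead_coefXaddC expr1n mulr1.
Qed.

(** Each of the p factors is an iterate of [sigma] on x1, hence has degree 2 in x2, because [sigma]
    only translates x2. *)
Lemma flow_lead_a3 : flow_lead (a3 k p) (2 * p).
Proof.
rewrite /a3; elim: (p) => [|m IHm]; first by rewrite big_ord0; apply: flow_lead1.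
rewrite big_ord_recr /= mulnS addnC; apply: flow_leadM => //.
by elim: m {IHm} => [|m IHm] /=; [apply: flow_lead_x1 | apply: flow_lead_sigma].
Qed.

Lemma flow_lead_Delta f d : flow_lead f d.+1 -> ~~ (p %| d.+1)%N -> flow_lead (Delta f) d.
Proof.
move=> [m [q [r [u [Cq eq szq u0 lq]]]]] ndvd.
have d0 : d.+1%:R != 0 :> k by rewrite -(dvdn_pcharf pchar_p).
exists m, (dpoly x3 q), r.+1, (u * d.+1%:R).
have [||-> ->] := @dpoly_lead _ x3 _ _ szq.
- by rewrite -mpolyC_nat mpolyC_eq0.
- exact: x3_neq0.
split=> //; last 2 first.
- exact: mulf_neq0.
- by rewrite lq -scalerAl -exprSr -scaler_nat scalerA mulrC.
- exact: flow_poly_dpoly.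
by rewrite -Delta_flow_poly // -eq DeltaM !rmorphXn /= sigmaX3 /Delta rmorphXn /= sigmaX3 subrr mul0r add0r.
Qed.

Lemma flow_lead_iter_Delta m f d : (m <= d %% p)%N ->
  flow_lead f d -> flow_lead (iter m (@Delta k) f) (d - m).
Proof.
have p_gt0 := prime_gt0 (pcharf_prime pchar_p).
elim: m f d => [|m IHm] f d le_m Lf; first by rewrite subn0.
case: d le_m Lf => [|d]; first by rewrite mod0n.
rewrite iterSr subSS => le_m Lf; apply: IHm.
  by move: le_m; rewrite modnS; case: ifP.
by apply: flow_lead_Delta => //; apply/negP => /eqP e0; rewrite e0 in le_m.
Qed.

Lemma flow_lead_Mpol j : flow_lead (Mpol k j) j.
Proof.
have L1 e := flow_leadX e flow_lead_x1.
rewrite /Mpol; case: ifP => odd_j.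
  by have := flow_leadM (L1 ((j - 1) %/ 2)%N) flow_lead_x2; congr flow_lead; lia.
by have := L1 (j %/ 2)%N; congr flow_lead; lia.
Qed.

Lemma flow_lead_Ppol j : (j < p)%N -> flow_lead (Ppol k p j) (2 * p - 1 - j).
Proof.
move=> lt_j; have L1 e := flow_leadX e flow_lead_x1.
rewrite /Ppol; case: eqP => [->|/eqP j0] /=.
  have -> : (2 * p - 1 - 0 = 2 * (p - 1) + 1)%N by lia.
  exact: (flow_leadM (L1 _) flow_lead_x2).
case: ifP => odd_j.
  by have := L1 (p - (j + 1) %/ 2)%N; congr flow_lead; lia.
apply: flow_lead_Delta.
  by have := L1 (p - j %/ 2)%N; congr flow_lead; lia.
have -> : ((2 * p - 1 - j).+1 = p + (p - j))%N by lia.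
by rewrite dvdn_addr // gtnNdvd //; lia.
Qed.

Lemma flow_lead_basisS n j : (n <= p)%N -> (j < n)%N ->
  (exists i, flow_lead (basisS k p n i) j) /\ (exists i, flow_lead (basisS k p n i) (p + j)).
Proof.
move=> le_n lt_j; split; first by exists (inl (Ordinal lt_j)); apply: flow_lead_Mpol.
(* P_i has degree 2p - 1 - i and [Delta] is applied p - n times, so the index giving degree p + j is
   n - 1 - j. *)
have lt_j' : (n - 1 - j < n)%N by lia.
exists (inr (Ordinal lt_j')) => /=.
have -> : (p + j = (2 * p - 1 - (n - 1 - j)) - (p - n))%N by lia.
apply: flow_lead_iter_Delta; last by apply: flow_lead_Ppol; lia.
have -> : (2 * p - 1 - (n - 1 - j) = p + (p - 1 - (n - 1 - j)))%N by lia.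
by rewrite modnDl modn_small; lia.
Qed.

Lemma flow_lead_span n d : (n <= p)%N -> (d %% p < n)%N ->
  exists i l, flow_lead (a3 k p ^+ l * basisS k p n i) d.
Proof.
move=> le_n lt_d; have L3 l := flow_leadX l flow_lead_a3.
have [[i Li] [j Lj]] := flow_lead_basisS le_n lt_d.
have dE := divn_eq d p; have d2E := odd_double_half (d %/ p)%N.
(* As a3 has degree 2p, its power accounts for the even part of the quotient d / p; when the
   quotient is odd, the basis element of degree p + (d mod p) supplies the remaining p. *)
case odd_q: (odd (d %/ p)%N) d2E => d2E; [exists j | exists i]; exists (d %/ p)./2.
  by have := flow_leadM (L3 (d %/ p)./2) Lj; congr flow_lead; lia.
by have := flow_leadM (L3 (d %/ p)./2) Li; congr flow_lead; lia.
Qed.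

End LocalizationAtX3.

(** * Saturation of the span, independence and generation *)

Section FreeBasis.
Variables (k : fieldType) (p n : nat).
Hypotheses (odd_p : odd p) (pchar_p : p \in [pchar k]) (le_n : (n <= p)%N).
Local Notation R := {mpoly k[3]}.
Local Notation x2 := (x2 k).
Local Notation x3 := (x3 k).
Local Notation A := (subalgA k p).

(** A nonzero multiple of x3^m has total degree at least m. *)
Lemma x3X_dvd_eq0 (f : R) : (forall m, exists g, f = x3 ^+ m * g) -> f = 0.
Proof.
move=> dvd_f; apply/eqP/negPn/negP => f0.
have lt_msize m (g : R) : g != 0 -> (m < msize (x3 ^+ m * g))%N.
  move=> g0; elim: m => [|m IHm]; first by rewrite expr0 mul1r lt0n msize_poly_eq0.
  rewrite exprS -mulrA msizeM ?x3_neq0 ?mulf_neq0 ?expf_neq0 ?x3_neq0 //.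
  by rewrite [msize x3]msizeX mdeg1.
have [g fE] := dvd_f (msize f).
have g0 : g != 0 by apply: contraNneq f0 => g0; rewrite fE g0 mulr0.
by have := lt_msize (msize f) g g0; rewrite -fE ltnn.
Qed.

Definition spanS f := exists2 c : 'I_n + 'I_n -> R,
  (forall i, A (c i)) & f = \sum_i c i * basisS k p n i.

Lemma spanS0 : spanS 0.
Proof.
by exists (fun=> 0) => [i|]; [apply: subalgA0 | rewrite big1 // => i _; rewrite mul0r].
Qed.

Lemma spanSD f g : spanS f -> spanS g -> spanS (f + g).
Proof.
move=> [c Ac ->] [d Ad ->]; exists (fun i => c i + d i) => [i|].
  by apply: SubalgAdd; [apply: Ac | apply: Ad].
by rewrite -big_split; apply: eq_bigr => i _; rewrite /= mulrDl.
Qed.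

Lemma spanSM a f : A a -> spanS f -> spanS (a * f).
Proof.
move=> Aa [c Ac ->]; exists (fun i => a * c i) => [i|].
  by apply: SubalgMul => //; apply: Ac.
by rewrite mulr_sumr; apply: eq_bigr => i _; rewrite mulrA.
Qed.

Lemma spanS_basisS i : spanS (basisS k p n i).
Proof.
exists (fun j => if j == i then 1 else 0) => [j|].
  by case: ifP => _; [apply: SubalgOne | apply: subalgA0].
rewrite (bigD1 i) //= eqxx mul1r big1 ?addr0 // => j /negPf->.
by rewrite mul0r.
Qed.

Lemma basisS_sum_x3 (c : 'I_n + 'I_n -> R) f : (forall i, A (c i)) ->
  x3 * f = \sum_i c i * basisS k p n i ->
  exists2 c' : 'I_n + 'I_n -> R, (forall i, A (c' i)) &
    (forall i, c i = x3 * c' i) /\ f = \sum_i c' i * basisS k p n i.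
Proof.
move=> Ac fE; have [|c' Ac' cE] := basisS_indep_mod_x3 odd_p pchar_p le_n Ac.
  by rewrite -fE rmorphM /= theta_x3 mul0r.
exists c' => //; split=> //; apply: (mulfI (x3_neq0 k)); rewrite fE mulr_sumr.
by apply: eq_bigr => i _; rewrite cE mulrA.
Qed.

Lemma spanS_x3X m f : spanS (x3 ^+ m * f) -> spanS f.
Proof.
elim: m => [|m IHm]; first by rewrite mul1r.
rewrite exprS -mulrA => -[c Ac] /(basisS_sum_x3 Ac)[c' Ac' [_ fE]].
by apply: IHm; exists c'.
Qed.

Lemma basisS_indep (c : 'I_n + 'I_n -> R) : (forall i, A (c i)) ->
  \sum_i c i * basisS k p n i = 0 -> forall i, c i = 0.
Proof.
move=> Ac sum0 i; apply: x3X_dvd_eq0 => m.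
elim: m c Ac sum0 => [|m IHm] c Ac sum0; first by exists (c i); rewrite mul1r.
(* Infinite descent: dividing a relation by x3 yields another relation over A, so the original
   coefficients are divisible by every power of x3. *)
have [|c' Ac' [cE sum0']] := @basisS_sum_x3 c 0 Ac; first by rewrite mulr0 sum0.
have [g gE] := IHm c' Ac' (esym sum0').
by exists g; rewrite cE gE exprS mulrA.
Qed.

Lemma kerDelta_basisS i : kerDelta k n (basisS k p n i).
Proof.
case: i => j /=; first by apply: kerDelta_le (kerDelta_Mpol k j); apply: ltn_ord.
by rewrite /kerDelta -iterD subnKC //; apply: iter_Delta_pchar.
Qed.

Lemma kerDelta_subalgAM a f : A a -> kerDelta k n f -> kerDelta k n (a * f).
Proof.
move=> Aa Kf; rewrite /kerDelta iter_DeltaMl ?[iter n _ f]Kf ?mulr0 //.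
exact: subalgA_sigma Aa.
Qed.

(** Cancelling a leading term replaces [f] by another element of the kernel, so the induction is on
    a bound for the degree in x2, with [f], [m] and [q] varying. *)
Lemma kerDelta_spanS_loc N f m q : kerDelta k n f -> flow_poly p q ->
  x3 ^+ m * f = q.[x2] -> (size q <= N)%N -> exists m', spanS (x3 ^+ m' * f).
Proof.
elim: N f m q => [|N IHN] f m q Kf Cq fE szq.
  exists m; rewrite fE; move: szq; rewrite leqn0 size_poly_eq0 => /eqP->.
  by rewrite horner0; apply: spanS0.
have [|lt_N] := leqP (size q) N; first exact: IHN fE.
have {szq lt_N} szq : size q = N.+1 by apply/eqP; rewrite eqn_leq szq.
(* Otherwise n differences would leave [q] nonzero, whereas its value at x2 is killed by the n-th
   power of [Delta] and x2 is transcendental over the coefficients. *)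
have ltNn : (N %% p < n)%N.
  rewrite ltnNge; apply/negP => le_nN.
  have pchar_R : p \in [pchar R].
    rewrite inE (pcharf_prime pchar_p) -mpolyC_nat mpolyC_eq0.
    by rewrite -(dvdn_pcharf pchar_p) dvdnn.
  have [Cn DnE] : flow_poly p (iter n (dpoly x3) q) /\
      iter n (@Delta k) q.[x2] = (iter n (dpoly x3) q).[x2].
    elim: (n) => [|e [Ce De]] //=; split; first exact: flow_poly_dpoly.
    by rewrite De (Delta_flow_poly odd_p pchar_p Ce).
  have /eqP[] := dpoly_iter_neq0 pchar_R (x3_neq0 k) szq le_nN.
  apply: (flow_poly_inj odd_p pchar_p Cn).
  by rewrite -DnE -fE; apply: kerDelta_subalgAM => //; apply/subalgAX/subalgA_a1.
have [i [l [m' [q' [r [u [Cq' gE szq' u0 lq']]]]]]] :=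
  flow_lead_span odd_p pchar_p le_n ltNn.
set g := a3 k p ^+ l * _ in gE.
have Ax e : A (x3 ^+ e) by apply/subalgAX/subalgA_a1.
have A3 : A (a3 k p ^+ l) by apply/subalgAX/subalgA_a3.
have Sg : spanS g by apply: spanSM (spanS_basisS i).
have Kg : kerDelta k n g by exact: (kerDelta_subalgAM A3 (kerDelta_basisS i)).
have Cl : flow_fixed p (lead_coef q) by rewrite lead_coefE; apply: Cq.
have Al : A (lead_coef q) by case: Cl.
have Cr : flow_fixed p (lead_coef q') by rewrite lead_coefE; apply: Cq'.
have Ar : A (lead_coef q') by case: Cr.
(* Cross-multiplying by the two leading coefficients cancels the terms of degree N without any
   division. *)
pose f' := lead_coef q' * (x3 ^+ m * f) - lead_coef q * (x3 ^+ m' * g).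
pose q'' := (lead_coef q')%:P * q - (lead_coef q)%:P * q'.
have Kf' : kerDelta k n f'.
  by rewrite /kerDelta iter_DeltaB ![iter n _ _]kerDelta_subalgAM ?subrr //;
    apply: kerDelta_subalgAM.
have Cq'' : flow_poly p q''.
  by apply: flow_polyB; apply: flow_polyM => //; apply: flow_polyC.
have f'E : x3 ^+ 0 * f' = q''.[x2] by rewrite mul1r !hornerE -fE -gE.
have szq'' : (size q'' <= N)%N.
  apply/leq_sizeP => j; rewrite leq_eqVlt => /predU1P[<-|lt_j].
    by rewrite coefB !coefCM !lead_coefE szq szq' mulrC subrr.
  by rewrite coefB !coefCM !nth_default ?szq ?szq' // !mulr0 subrr.
have [M SM] := IHN f' 0%N q'' Kf' Cq'' f'E szq''.
(* [M] comes from the induction, [r] from the leading coefficient u x3^r of [q'], and [m] from the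
   representation of [f]; the scalar u is inverted in k. *)
exists (M + r + m)%N.
have -> : x3 ^+ (M + r + m) * f = u^-1%:MP *
    (x3 ^+ M * f' + x3 ^+ M * (lead_coef q * (x3 ^+ m' * g))).
  rewrite -mulrDr subrK lq' mul_mpolyC -scalerAl -scalerAr scalerA mulVf // scale1r.
  by rewrite !exprD; ring.
apply: spanSM; first exact: subalgAC.
by apply: spanSD => //; do 3!apply: spanSM => //.
Qed.

End FreeBasis.

Theorem theorem17 (k : fieldType) (p n : nat)
    (p_prime : prime p) (p_odd : odd p) (p_char : p \in [pchar k])
    (n_ge1 : (1 <= n)%N) (n_lep : (n <= p)%N) :
  free_module_on (subalgA k p) (kerDelta k n) (basisS k p n).
Proof.
split; [split | | |].
- exact: iter_Delta0.
- by move=> f g Kf Kg; rewrite /kerDelta iter_DeltaD [iter n _ f]Kf [iter n _ g]Kg addr0.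
- by move=> a f; apply: kerDelta_subalgAM.
- exact: kerDelta_basisS.
- move=> f Kf; have [m [q [Cq fE]]] := flow_poly_repr p_odd p_char f.
  have [m' Sf] := kerDelta_spanS_loc p_odd p_char n_lep Kf Cq fE (leqnn _).
  exact: spanS_x3X Sf.
- exact: basisS_indep.
Qed.
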